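(* Consider the Cascadic Multilevel (CM) algorithm for the saddle point problem: find $(\mathbf{u},p)\in\mathbf{V}\times Q$ with $a(\mathbf{u},\mathbf{v})+b(\mathbf{v},p)=\langle\mathbf{f},\mathbf{v}\rangle$ for all $\mathbf{v}\in\mathbf{V}$ and $b(\mathbf{u},q)=\langle g,q\rangle$ for all $q\in Q$. Let $(\mathbf{u},p)$ be its solution and assume: (A1) There exists $m_0>0$ such that $m_k\ge m_0$ for all $k=1,2,\dots$. (A2) The process used on each level is Step 2 of the Uzawa (U), Uzawa gradient (UG) or Uzawa conjugate gradient (UCG) algorithm; in the Uzawa case $\alpha_0\in(0,2/M^2)$. (A3) If $(\mathbf{u}^{(k)},p^{(k)})\in\mathbf{V}_k\times\mathcal{M}_k$ is the solution of the discrete problem on $(\mathbf{V}_k,\mathcal{M}_k)$, then there exist $C_0=C_0(\mathbf{u},p)$ and $s>0$, independent of $k$, such that $|\mathbf{u}-\mathbf{u}^{(k)}|+\|p-p^{(k)}\|\le C_0h_k^s$ for all $k\geq 1$. (A4) The level change condition is (LC): $\|q_{j+1}\|\le C_{lc}h_k^s$, where $C_{lc}$ is a constant independent of $k$. Then there exists a constant $C$, depending only on $m_0$, $M$, $C_0$, $C_{lc}$ (and on $\alpha_0$ in the Uzawa case), such that for every $k\ge1$, if $(\mathbf{u}_{j+1},p_j)$ is the last iterate computed by the CM algorithm on $(\mathbf{V}_k,\mathcal{M}_k)$, then $$|\mathbf{u}-\mathbf{u}_{j+1}|+\|p-p_j\|\le C\,h_k^s.$$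
   Context: Setting. $\mathbf{V}$ and $Q$ are real Hilbert spaces with inner products $a(\cdot,\cdot)$ and $(\cdot,\cdot)$ and induced norms $|\cdot|=a(\cdot,\cdot)^{1/2}$ and $\|\cdot\|=(\cdot,\cdot)^{1/2}$, respectively; $\langle\cdot,\cdot\rangle$ denotes the duality pairings on $\mathbf{V}^*\times\mathbf{V}$ and $Q^*\times Q$; $\mathbf{f}\in\mathbf{V}^*$, $g\in Q^*$. $b(\cdot,\cdot)$ is a bilinear form on $\mathbf{V}\times Q$ with $$\inf_{p\in Q}\sup_{\mathbf{v}\in\mathbf{V}}\frac{b(\mathbf{v},p)}{\|p\|\,|\mathbf{v}|}=m>0,\qquad \sup_{p\in Q}\sup_{\mathbf{v}\in\mathbf{V}}\frac{b(\mathbf{v},p)}{\|p\|\,|\mathbf{v}|}=M<\infty$$ (infima and suprema over nonzero elements here and below). For $k\ge1$, $\mathbf{V}_k\subset\mathbf{V}$ and $\mathcal{M}_k\subset Q$ are nonzero finite-dimensional subspaces satisfying a discrete inf-sup condition $m_k>0$, where $$m_k:=\inf_{p_k\in\mathcal{M}_k}\sup_{\mathbf{v}_k\in\mathbf{V}_k}\frac{b(\mathbf{v}_k,p_k)}{\|p_k\|\,|\mathbf{v}_k|},\qquad M_k:=\sup_{p_k\in\mathcal{M}_k}\sup_{\mathbf{v}_k\in\mathbf{V}_k}\frac{b(\mathbf{v}_k,p_k)}{\|p_k\|\,|\mathbf{v}_k|}\le M.$$ $h_k>0$ is a mesh parameter associated with $(\mathbf{V}_k,\mathcal{M}_k)$,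 with $h_k\to0$. Prolongation operators $\mathcal{P}_{k,k+1}:\mathcal{M}_k\to\mathcal{M}_{k+1}$ are given (no further properties are assumed). The discrete problem on $(\mathbf{V}_k,\mathcal{M}_k)$ is: find $(\mathbf{u}^{(k)},p^{(k)})\in\mathbf{V}_k\times\mathcal{M}_k$ with $a(\mathbf{u}^{(k)},\mathbf{v})+b(\mathbf{v},p^{(k)})=\langle\mathbf{f},\mathbf{v}\rangle$ for all $\mathbf{v}\in\mathbf{V}_k$ and $b(\mathbf{u}^{(k)},q)=\langle g,q\rangle$ for all $q\in\mathcal{M}_k$. CM algorithm. Start with $j=1$, $k=1$ and an arbitrary $p_0\in\mathcal{M}_1$. CM1 (start of level $k$): given $p_{j-1}\in\mathcal{M}_k$, compute $\mathbf{u}_j\in\mathbf{V}_k$ and $q_j\in\mathcal{M}_k$ from $a(\mathbf{u}_j,\mathbf{v})=\langle\mathbf{f},\mathbf{v}\rangle-b(\mathbf{v},p_{j-1})$ for all $\mathbf{v}\in\mathbf{V}_k$ and $(q_j,q)=b(\mathbf{u}_j,q)-\langle g,q\rangle$ for all $q\in\mathcal{M}_k$; in the UCG case also set $d_j:=q_j$. CM2: compute $(\mathbf{u}_{j+1},p_j)$ and $q_{j+1}$ from the current data by one step of the chosen process on $(\mathbf{V}_k,\mathcal{M}_k)$: - U and UG: $\mathbf{h}_j\in\mathbf{V}_k$ solves $a(\mathbf{h}_j,\mathbf{v})=-b(\mathbf{v},q_j)$ for all $\mathbf{v}\in\mathbf{V}_k$; $\alpha_j=\alpha_0$ (fixed)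 for U, or $\alpha_j=-\frac{(q_j,q_j)}{b(\mathbf{h}_j,q_j)}$ for UG; $p_j=p_{j-1}+\alpha_jq_j$; $\mathbf{u}_{j+1}=\mathbf{u}_j+\alpha_j\mathbf{h}_j$; $q_{j+1}\in\mathcal{M}_k$ solves $(q_{j+1},q)=b(\mathbf{u}_{j+1},q)-\langle g,q\rangle$ for all $q\in\mathcal{M}_k$. - UCG: $\mathbf{h}_j\in\mathbf{V}_k$ solves $a(\mathbf{h}_j,\mathbf{v})=-b(\mathbf{v},d_j)$ for all $\mathbf{v}\in\mathbf{V}_k$; $\alpha_j=-\frac{(q_j,q_j)}{b(\mathbf{h}_j,q_j)}$; $p_j=p_{j-1}+\alpha_jd_j$; $\mathbf{u}_{j+1}=\mathbf{u}_j+\alpha_j\mathbf{h}_j$; $q_{j+1}\in\mathcal{M}_k$ solves $(q_{j+1},q)=b(\mathbf{u}_{j+1},q)-\langle g,q\rangle$ for all $q\in\mathcal{M}_k$; $\beta_j=\frac{(q_{j+1},q_{j+1})}{(q_j,q_j)}$; $d_{j+1}=q_{j+1}+\beta_jd_j$. (In UG and UCG, if $q_j=0$, the undefined quotients $\alpha_j$, $\beta_j$ are set to $0$.) CM3: check the level change condition (LC). If it is not satisfied, replace $j$ by $j+1$ and repeat CM2. If it is satisfied, $(\mathbf{u}_{j+1},p_j)$ is the last iterate on level $k$; set $p_0^{(k+1)}:=\mathcal{P}_{k,k+1}(p_j)$, replace $k$ by $k+1$ and $j$ by $j+1$, and go to CM1 with $p_{j-1}=p_0^{(k+1)}$. *)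

(* Defs.v *)
From mathcomp Require Import all_boot all_order all_algebra.
From mathcomp Require Import all_classical all_reals all_analysis.

Set Implicit Arguments.
Unset Strict Implicit.
Unset Printing Implicit Defensive.

Import Order.TTheory GRing.Theory Num.Theory.
Import numFieldNormedType.Exports.

Local Open Scope classical_set_scope.
Local Open Scope ring_scope.

(* A Hilbert space is a complete normed module together with an inner product
   (a [{dot _ for idfun}], i.e. a positive definite symmetric bilinear form)
   that induces its norm. *)
Definition induces_norm (R : realType) (H : completeNormedModType R)
    (ip : {dot H for idfun}) : Prop :=
  forall x : H, `|x| = Num.sqrt (ip x x).

Definition fin_dim_subspace (R : realType) (H : lmodType R) (W : set H) : Prop :=
  exists (n : nat) (e : 'I_n -> H),
    W = [set x | exists c : 'I_n -> R, x = \sum_(i < n) c i *: e i].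

Definition nonzero_set (H : zmodType) (W : set H) : Prop :=
  exists2 x : H, W x & x != 0.

(* One step of Uzawa (with relaxation parameter alpha_0), Uzawa gradient or
   Uzawa conjugate gradient. *)
Variant process (R : realType) :=
  | Uzawa of R
  | UzawaGradient
  | UzawaConjugateGradient.
Arguments UzawaGradient {R}.
Arguments UzawaConjugateGradient {R}.

(* [alpha0 = Some al] when the value al is the fixed parameter of the Uzawa
   process, and [alpha0 = None] when the Uzawa process is not used. *)
Definition admissible_process (R : realType) (M : R) (alpha0 : option R)
    (pr : process R) : Prop :=
  match pr with
  | Uzawa al => alpha0 = Some al /\ 0 < al < 2 / M ^+ 2
  | UzawaGradient => True
  | UzawaConjugateGradient => True
  end.

(* The data u_j, p_{j-1}, q_j, d_j available when CM2 is entered with index j;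
   the component d is only read by the conjugate gradient process. *)
Record iterate (V Q : Type) :=
  Iterate { it_u : V ; it_p : Q ; it_q : Q ; it_d : Q }.

Section SaddlePoint.
Context {R : realType} {V Q : completeNormedModType R}.

Section InfSup.
Variable b : {bilinear V -> Q -> R | *%R & *%R}.

Definition sup_quotient (W : set V) (p : Q) : \bar R :=
  ereal_sup [set (b v p / (`|p| * `|v|))%:E | v in [set v | W v /\ v != 0]].

Definition inf_sup (W : set V) (S : set Q) : \bar R :=
  ereal_inf [set sup_quotient W p | p in [set p | S p /\ p != 0]].

Definition sup_sup (W : set V) (S : set Q) : \bar R :=
  ereal_sup [set sup_quotient W p | p in [set p | S p /\ p != 0]].

End InfSup.

Variables (a : {dot V for idfun}) (ip : {dot Q for idfun}).
Variable b : {bilinear V -> Q -> R | *%R & *%R}.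
Variables (f : {scalar V}) (g : {scalar Q}).

Definition saddle_solution (W : set V) (S : set Q) (u : V) (p : Q) : Prop :=
  [/\ W u, S p,
      forall v, W v -> a u v + b v p = f v
    & forall q, S q -> b u q = g q].

Definition residual (S : set Q) (u : V) (q : Q) : Prop :=
  S q /\ forall r, S r -> ip q r = b u r - g r.

Definition direction (W : set V) (d : Q) (w : V) : Prop :=
  W w /\ forall v, W v -> a w v = - b v d.

Definition cm1 (W : set V) (S : set Q) (p : Q) (x : iterate V Q) : Prop :=
  [/\ it_p x = p,
      W (it_u x) /\ (forall v, W v -> a (it_u x) v = f v - b v p),
      residual S (it_u x) (it_q x)
    & it_d x = it_q x].

Definition update (S : set Q) (alpha : R) (d : Q) (w : V)
    (x y : iterate V Q) : Prop :=
  [/\ it_p y = it_p x + alpha *: d,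
      it_u y = it_u x + alpha *: w
    & residual S (it_u y) (it_q y)].

Definition gradient_alpha (q : Q) (w : V) : R :=
  if q == 0 then 0 else - (ip q q / b w q).

Definition conjugate_beta (q q' : Q) : R :=
  if q == 0 then 0 else ip q' q' / ip q q.

Definition cm2 (pr : process R) (W : set V) (S : set Q)
    (x y : iterate V Q) : Prop :=
  match pr with
  | Uzawa alpha0 =>
      exists w : V,
        [/\ direction W (it_q x) w,
            update S alpha0 (it_q x) w x y
          & it_d y = it_d x]
  | UzawaGradient =>
      exists w : V,
        [/\ direction W (it_q x) w,
            update S (gradient_alpha (it_q x) w) (it_q x) w x y
          & it_d y = it_d x]
  | UzawaConjugateGradient =>
      exists w : V,
        [/\ direction W (it_d x) w,
            update S (gradient_alpha (it_q x) w) (it_d x) w x y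
          & it_d y = it_q y + conjugate_beta (it_q x) (it_q y) *: it_d x]
  end.

Section Cascadic.
Variables (Vk : nat -> set V) (Mk : nat -> set Q).
Variables (pr : nat -> process R) (prol : nat -> Q -> Q).
Variable LC : nat -> Q -> bool.

(* [cm_run k j x]: a run of the algorithm reaches CM2 on level k with index j
   and current data x; levels are numbered from 1. *)
Inductive cm_run : nat -> nat -> iterate V Q -> Prop :=
| cm_start p0 x :
    Mk 1 p0 -> cm1 (Vk 1) (Mk 1) p0 x -> cm_run 1 1 x
| cm_repeat k j x y :
    cm_run k j x -> cm2 (pr k) (Vk k) (Mk k) x y -> ~~ LC k (it_q y) ->
    cm_run k j.+1 y
| cm_next_level k j x y z :
    cm_run k j x -> cm2 (pr k) (Vk k) (Mk k) x y -> LC k (it_q y) ->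
    cm1 (Vk k.+1) (Mk k.+1) (prol k (it_p y)) z ->
    cm_run k.+1 j.+1 z.

(* [(u', p')] is the last iterate (u_{j+1}, p_j) on level k. *)
Definition cm_last_iterate (k j : nat) (u' : V) (p' : Q) : Prop :=
  exists x y : iterate V Q,
    [/\ cm_run k j x, cm2 (pr k) (Vk k) (Mk k) x y, LC k (it_q y)
      & u' = it_u y /\ p' = it_p y].

End Cascadic.
End SaddlePoint.

(* Main.v *)
(* On each level let (e_u, e_p) be the difference between the discrete solution
   and the iterate (u_{j+1}, p_j).  Whatever the step size and the search
   direction, every step preserves the momentum equation
   a(u_{j+1}, v) + b(v, p_j) = f(v) on V_k, so a(e_u, v) + b(v, e_p) = 0 on V_k,
   and by definition of the residual b(e_u, q) = -(q_{j+1}, q) on M_k.  Hence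
   |e_u|^2 = (q_{j+1}, e_p) <= ||q_{j+1}|| ||e_p||, while the discrete inf-sup
   condition gives m_0 ||e_p|| <= |e_u|; so
   |e_u| <= ||q_{j+1}|| / m_0 and ||e_p|| <= ||q_{j+1}|| / m_0^2.  The level
   change condition and the approximation assumption conclude.  The same estimate
   with zero residual shows that the discrete problem is uniquely solvable. *)

Require Import Defs.
From mathcomp Require Import all_boot all_order all_algebra.
From mathcomp Require Import all_classical all_reals all_analysis.
From mathcomp Require Import ring.

Set Implicit Arguments.
Unset Strict Implicit.
Unset Printing Implicit Defensive.

Import Order.TTheory GRing.Theory Num.Theory.
Import numFieldNormedType.Exports.

Local Open Scope classical_set_scope.
Local Open Scope ring_scope.

(** * Linear algebra: spans of finite families and solvability of linear systems *)

Lemma fin_dim_subspace_lin (R : realType) (H : lmodType R) (W : set H) (c : R)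
    (x y : H) :
  fin_dim_subspace W -> W x -> W y -> W (c *: x + y).
Proof.
move=> [n [e ->]] [cx ->] [cy ->]; exists (fun i => c * cx i + cy i).
rewrite scaler_sumr -big_split /=; apply: eq_bigr => i _.
by rewrite scalerDl scalerA.
Qed.

Lemma fin_dim_subspaceB (R : realType) (H : lmodType R) (W : set H) (x y : H) :
  fin_dim_subspace W -> W x -> W y -> W (x - y).
Proof.
by move=> Wfin Wx Wy; rewrite addrC -scaleN1r; apply: fin_dim_subspace_lin.
Qed.

(** Fredholm alternative for a possibly singular matrix: the columns of [cokermx G] lie in the
    kernel of [G], and [l] is in the row space as soon as it annihilates them. *)
Lemma mulmx_solvable (F : fieldType) (m n : nat) (G : 'M[F]_(m, n)) (l : 'rV[F]_n) :
  (forall d : 'cV[F]_n, G *m d = 0 -> l *m d = 0) ->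
  exists c : 'rV[F]_m, c *m G = l.
Proof.
move=> kerGl; suff /submxP[c ->] : (l <= G)%MS by exists c.
rewrite submxE; apply/eqP/matrixP => i j; rewrite [RHS]mxE.
have /kerGl/matrixP/(_ i 0) : G *m col j (cokermx G) = 0.
  by rewrite colE mulmxA mulmx_coker mul0mx.
by rewrite !mxE => lj0; rewrite -[RHS]lj0; apply: eq_bigr => k _; rewrite [in RHS]mxE.
Qed.

(** * The Cauchy-Schwarz inequality *)

Section InnerProduct.
Variables (R : realType) (H : completeNormedModType R).
Variable ip : {dot H for idfun}.
Hypothesis ip_norm : induces_norm ip.

Lemma inner_norm x : ip x x = `|x| ^+ 2.
Proof.
rewrite ip_norm sqr_sqrtr //; have [->|x0] := eqVneq x 0.
  by rewrite linear0r.
exact/ltW/neq0_dnorm_gt0.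
Qed.

Lemma inner_sym x y : ip x y = ip y x.
Proof. by rewrite hermC expr0 mul1r. Qed.

(** The square of the norm of [|y| x + |x| y] is nonnegative and factors as
    [2 |x| |y| (ip x y + |x| |y|)]; dividing by the positive factor gives the bound. *)
Lemma inner_ge (x y : H) : - (`|x| * `|y|) <= ip x y.
Proof.
have [->|x0] := eqVneq x 0; first by rewrite linear0l normr0 mul0r oppr0.
have [->|y0] := eqVneq y 0; first by rewrite linear0r normr0 mulr0 oppr0.
have xy_gt0 : 0 < `|x| * `|y| by rewrite mulr_gt0 ?normr_gt0.
have : 0 <= ip (`|y| *: x + `|x| *: y) (`|y| *: x + `|x| *: y).
  by rewrite inner_norm exprn_ge0.
have -> : ip (`|y| *: x + `|x| *: y) (`|y| *: x + `|x| *: y) =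
    2 * (`|x| * `|y| * (ip x y + `|x| * `|y|)).
  rewrite !linearDl !linearDr /= !linearZl_LR !linearZr_LR /= !inner_norm.
  by rewrite (inner_sym y x) /GRing.scale /=; ring.
by rewrite !pmulr_rge0 // -lerBlDr sub0r.
Qed.

Lemma inner_le (x y : H) : ip x y <= `|x| * `|y|.
Proof. by have := inner_ge (- x) y; rewrite linearNl normrN lerN2. Qed.

End InnerProduct.

(** * Stability and solvability of the discrete saddle point problem *)

Section DiscreteProblem.
Variables (R : realType) (V Q : completeNormedModType R).
Variables (a : {dot V for idfun}) (ip : {dot Q for idfun}).
Hypotheses (a_norm : induces_norm a) (ip_norm : induces_norm ip).
Variable b : {bilinear V -> Q -> R | *%R & *%R}.
Variables (f : {scalar V}) (g : {scalar Q}).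
Variables (W : set V) (S : set Q).
Hypotheses (Wfin : fin_dim_subspace W) (Sfin : fin_dim_subspace S).
Variable m : R.
Hypotheses (m_gt0 : 0 < m) (m_inf_sup : (m%:E <= inf_sup b W S)%E).

(** Quotient-free form of the inf-sup condition: the dual norm of [b(., q)] on [W] is at least
    [m |q|], so every bound [K] for it is too. *)
Lemma inf_sup_bound (q : Q) (K : R) :
  S q -> 0 <= K -> (forall v, W v -> b v q <= K * `|v|) -> m * `|q| <= K.
Proof.
move=> Sq K0 bK; have [->|q0] := eqVneq q 0; first by rewrite normr0 mulr0.
have q_gt0 : 0 < `|q| by rewrite normr_gt0.
rewrite -ler_pdivlMr // -lee_fin; apply: le_trans m_inf_sup _.
apply: (@le_trans _ _ (sup_quotient b W q)).
  by apply: ereal_inf_lbound; exists q.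
apply: ge_ereal_sup => _ [v [Wv v0] <-].
have v_gt0 : 0 < `|v| by rewrite normr_gt0.
rewrite lee_fin ler_pdivrMr ?mulr_gt0 // mulrA divfK ?gt_eqF //.
exact: bK.
Qed.

Lemma saddle_stability (w : V) (q r : Q) :
  W w -> S q -> (forall v, W v -> a w v + b v q = 0) ->
  b w q = - ip r q ->
  `|w| <= `|r| / m /\ `|q| <= `|r| / m ^+ 2.
Proof.
move=> Ww Sq momentum bwq.
have mq_le : m * `|q| <= `|w|.
  apply: inf_sup_bound => // v Wv.
  have -> : b v q = - a w v by apply/eqP; rewrite -addr_eq0 addrC momentum.
  by rewrite lerNl inner_ge.
have w2_le : `|w| ^+ 2 <= `|r| * `|q|.
  rewrite -(inner_norm a_norm).
  have -> : a w w = ip r q.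
    by apply/eqP; rewrite -subr_eq0 -bwq momentum.
  exact: inner_le.
have w_le : `|w| <= `|r| / m.
  have [->|w0] := eqVneq w 0; first by rewrite normr0 divr_ge0 // ltW.
  have w_gt0 : 0 < `|w| by rewrite normr_gt0.
  (* Multiplied by [|w|], the goal follows from the chain [|w|^2 m <= |r| |q| m <= |r| |w|]. *)
  rewrite ler_pdivlMr // -(ler_pM2l w_gt0) mulrA -expr2.
  apply: (@le_trans _ _ (`|r| * `|q| * m)).
    by rewrite ler_pM2r.
  by rewrite -mulrA [`|w| * _]mulrC ler_wpM2l // mulrC.
split=> //; rewrite expr2 invfM mulrA ler_pdivlMr // mulrC.
exact: le_trans mq_le _.
Qed.

(** The approximation assumption speaks only of given discrete solutions, so one must be exhibited.
    The spanning families may be linearly dependent, which makes the block matrix singular; hence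
    the Fredholm alternative instead of an inverse. *)
Lemma saddle_solvable : exists u p, saddle_solution a b f g W S u p.
Proof.
have [n [e We]] := Wfin; have [l [s Ss]] := Sfin.
pose A := \matrix_(i < n, j < n) a (e i) (e j).
pose B := \matrix_(i < n, j < l) b (e i) (s j).
pose F := row_mx (\row_j f (e j)) (\row_j g (s j)).
have [d|c cG] := @mulmx_solvable _ _ _ (block_mx A B B^T 0) F.
  rewrite -[d]vsubmxK mul_block_col mul0mx addr0 mul_row_col -col_mx0.
  case/eq_col_mx; set x := usubmx d; set y := dsubmx d => momentum mass.
  pose w := \sum_i x i 0 *: e i; pose q := \sum_j y j 0 *: s j.
  have Ww : W w by rewrite We; exists (x^~ 0).
  have Sq : S q by rewrite Ss; exists (y^~ 0).
  have aw v : W v -> a w v + b v q = 0.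
    rewrite We => -[c ->].
    rewrite linear_sumr linear_sumlz -big_split big1 // => i _.
    rewrite /= linearZr_LR linearZl_LR /= -mulrDr.
    move/matrixP/(_ i 0) : momentum; rewrite !mxE => ei0.
    suff -> : a w (e i) + b (e i) q = 0 by rewrite mulr0.
    (* Symmetry of [a] turns a row of the kernel equation into the homogeneous momentum equation
       tested with [e i]. *)
    rewrite -[RHS]ei0 linear_sumlz linear_sumr; congr (_ + _).
      by apply: eq_bigr => j _; rewrite [A i j]mxE linearZl_LR inner_sym mulrC.
    by apply: eq_bigr => j _; rewrite [B i j]mxE linearZr_LR mulrC.
  have bw : b w q = 0.
    rewrite linear_sumr big1 // => j _; rewrite linearZr_LR /= linear_sumlz.
    move/matrixP/(_ j 0) : mass; rewrite !mxE => sj0.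
    suff -> : \sum_i b (x i 0 *: e i) (s j) = 0 by rewrite mulr0.
    rewrite -[RHS]sj0; apply: eq_bigr => i _.
    by rewrite [B^T _ _]mxE [B _ _]mxE linearZl_LR mulrC.
  (* With residual 0, stability forces [w = 0] and [q = 0]. The load vector applied to [d] is
     [f w + g q], hence it vanishes. *)
  have [] := @saddle_stability w q 0 Ww Sq aw.
    by rewrite linear0l oppr0.
  rewrite normr0 !mul0r !normr_le0 => /eqP w0 /eqP q0.
  apply/matrixP => i j; rewrite !ord1 !mxE -[RHS]addr0; congr (_ + _).
    rewrite -[RHS](linear0 f) -w0 linear_sum; apply: eq_bigr => k _.
    by rewrite [in LHS]mxE linearZ mulrC.
  rewrite -[RHS](linear0 g) -q0 linear_sum; apply: eq_bigr => k _.
  by rewrite [in LHS]mxE linearZ mulrC.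
(* The two blocks of [c] are the coefficients of the discrete velocity and pressure. *)
move: cG; rewrite -[c]hsubmxK mul_row_block mulmx0 addr0.
case/eq_row_mx; set x := lsubmx c; set y := rsubmx c => momentum mass.
exists (\sum_i x 0 i *: e i), (\sum_j y 0 j *: s j).
split; [by rewrite We; exists (x 0)|by rewrite Ss; exists (y 0)| |].
- rewrite We => _ [cv ->].
  rewrite linear_sumr [in X in _ + X]linear_sumlz -big_split linear_sum.
  apply: eq_bigr => i _.
  rewrite /= linearZr_LR linearZl_LR linearZ /= -mulrDr; congr (_ * _).
  move/matrixP/(_ 0 i) : momentum; rewrite !mxE => <-.
  rewrite linear_sumlz linear_sumr; congr (_ + _).
    by apply: eq_bigr => j _; rewrite [A j i]mxE linearZl_LR.
  by apply: eq_bigr => j _; rewrite [B^T j i]mxE [B i j]mxE linearZr_LR.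
- rewrite Ss => _ [cq ->].
  rewrite linear_sumr linear_sum; apply: eq_bigr => j _.
  rewrite linearZr_LR linearZ /=; congr (_ * _).
  move/matrixP/(_ 0 j) : mass; rewrite !mxE => <-.
  by rewrite linear_sumlz; apply: eq_bigr => i _; rewrite [B i j]mxE linearZl_LR.
Qed.

(** * The invariant kept by all three processes, and the resulting error bound *)

Definition consistent (x : iterate V Q) : Prop :=
  [/\ W (it_u x), S (it_p x),
      forall v, W v -> a (it_u x) v + b v (it_p x) = f v,
      residual ip b g S (it_u x) (it_q x)
    & S (it_d x)].

Lemma cm1_consistent (p : Q) (x : iterate V Q) :
  S p -> cm1 a ip b f g W S p x -> consistent x.
Proof.
move=> Sp [xp [Wu xu] xq xd]; split=> //; rewrite ?xp ?xd //; last by case: xq.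
by move=> v Wv; rewrite xu // subrK.
Qed.

(** The contribution [alpha a(w, v)] cancels [alpha b(v, d)]. As [alpha] is arbitrary, this covers
    the fixed step, the quotient and its default value 0 alike. *)
Lemma update_consistent (alpha : R) (d : Q) (w : V) (x y : iterate V Q) :
  consistent x -> S d -> direction a b W d w ->
  update ip b g S alpha d w x y -> S (it_d y) -> consistent y.
Proof.
move=> [Wu Sp xu _ _] Sd [Ww dw] [yp yu yq] Syd; split=> //.
- by rewrite yu addrC; apply: fin_dim_subspace_lin.
- by rewrite yp addrC; apply: fin_dim_subspace_lin.
- move=> v Wv; rewrite yp yu linearDl linearDr linearZl_LR linearZr_LR /= dw //.
  by rewrite mulrN addrACA addNr addr0 xu.
Qed.

Lemma cm2_consistent (pr : process R) (x y : iterate V Q) :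
  consistent x -> cm2 a ip b g pr W S x y -> consistent y.
Proof.
move=> cx; have [_ _ _ [Sq _] Sd] := cx.
case: pr => [alpha0||] /= [w [dir upd yd]].
- by apply: update_consistent dir upd _; rewrite ?yd.
- by apply: update_consistent dir upd _; rewrite ?yd.
(* The new conjugate direction stays in [S], being a combination of the new residual and the old
   direction. *)
- apply: update_consistent dir (upd) _ => //.
  rewrite yd addrC; apply: fin_dim_subspace_lin => //.
  by case: upd => _ _ [].
Qed.

(** Subtracting the equations of the iterate from the discrete ones leaves a homogeneous momentum
    equation and the residual [it_q x] in the mass equation, so stability applies. *)
Lemma consistent_error (u : V) (p : Q) (x : iterate V Q) :
  saddle_solution a b f g W S u p -> consistent x ->
  `|u - it_u x| + `|p - it_p x| <= (m^-1 + (m ^+ 2)^-1) * `|it_q x|.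
Proof.
move=> [Wu Sp up ug] [Wxu Sxp xup [Sq xq] _].
have Spx : S (p - it_p x) by exact: fin_dim_subspaceB.
have [||||uB pB] := @saddle_stability (u - it_u x) (p - it_p x) (it_q x).
- exact: fin_dim_subspaceB.
- by [].
- by move=> v Wv; rewrite linearBl linearBr addrACA -opprD up // xup // subrr.
- by rewrite linearBl ug // xq // opprB.
by rewrite mulrDl [m^-1 * _]mulrC [_^-1 * _]mulrC lerD.
Qed.

End DiscreteProblem.

(** On a level change, CM1 restores the invariant from any starting pressure in the new space, and
    the prolongation lands there. *)
Lemma cm_run_consistent (R : realType) (V Q : completeNormedModType R)
    (a : {dot V for idfun}) (ip : {dot Q for idfun})
    (b : {bilinear V -> Q -> R | *%R & *%R}) (f : {scalar V}) (g : {scalar Q})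
    (Vk : nat -> set V) (Mk : nat -> set Q) (pr : nat -> process R)
    (prol : nat -> Q -> Q) (LC : nat -> Q -> bool)
    (Vk_fin : forall k, (1 <= k)%N -> fin_dim_subspace (Vk k))
    (Mk_fin : forall k, (1 <= k)%N -> fin_dim_subspace (Mk k))
    (prol_Mk : forall k, (1 <= k)%N -> forall q, Mk k q -> Mk k.+1 (prol k q))
    (k j : nat) (x : iterate V Q) :
  cm_run a ip b f g Vk Mk pr prol LC k j x ->
  (1 <= k)%N /\ consistent a ip b f g (Vk k) (Mk k) x.
Proof.
elim=> {k j x} [p0 x Mp0 x1|k j x y _ [k1 cx] xy _|k j x y z _ [k1 cx] xy _ z1].
- by split=> //; apply: cm1_consistent x1.
- by split=> //; apply: cm2_consistent xy => //; [exact: Vk_fin|exact: Mk_fin].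
- split=> //; apply: cm1_consistent z1; apply: prol_Mk => //.
  have := cm2_consistent (Vk_fin _ k1) (Mk_fin _ k1) cx xy.
  by case.
Qed.

Theorem theorem4p1 (R : realType) (m0 M C0 Clc : R) (alpha0 : option R)
  (m0_gt0 : 0 < m0) :
  exists C : R,
  forall (V Q : completeNormedModType R)
    (a : {dot V for idfun}) (ip : {dot Q for idfun})
    (a_norm : induces_norm a) (ip_norm : induces_norm ip)
    (f : {scalar V}) (g : {scalar Q})
    (f_cont : continuous f) (g_cont : continuous g)
    (b : {bilinear V -> Q -> R | *%R & *%R})
    (b_inf_sup : (0 < inf_sup b setT setT)%E)
    (b_sup_sup : sup_sup b setT setT = M%:E)
    (Vk : nat -> set V) (Mk : nat -> set Q)
    (Vk_fin : forall k, (1 <= k)%N ->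
       fin_dim_subspace (Vk k) /\ nonzero_set (Vk k))
    (Mk_fin : forall k, (1 <= k)%N ->
       fin_dim_subspace (Mk k) /\ nonzero_set (Mk k))
    (mk_gt0 : forall k, (1 <= k)%N -> (0 < inf_sup b (Vk k) (Mk k))%E)
    (h : nat -> R)
    (h_gt0 : forall k, (1 <= k)%N -> 0 < h k)
    (h_cvg0 : h k @[k --> \oo] --> (0 : R))
    (prol : nat -> Q -> Q)
    (prol_Mk : forall k, (1 <= k)%N ->
       forall q, Mk k q -> Mk k.+1 (prol k q))
    (u : V) (p : Q)
    (up_sol : saddle_solution a b f g setT setT u p)
    (A1 : forall k, (1 <= k)%N -> (m0%:E <= inf_sup b (Vk k) (Mk k))%E)
    (pr : nat -> process R)
    (A2 : forall k, (1 <= k)%N -> admissible_process M alpha0 (pr k))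
    (s : R) (s_gt0 : 0 < s)
    (A3 : forall k, (1 <= k)%N -> forall (uk : V) (pk : Q),
       saddle_solution a b f g (Vk k) (Mk k) uk pk ->
       `|u - uk| + `|p - pk| <= C0 * h k `^ s)
    (LC : nat -> Q -> bool)
    (A4 : forall k q, LC k q = (`|q| <= Clc * h k `^ s))
    (k : nat) (k_ge1 : (1 <= k)%N) (j : nat) (u' : V) (p' : Q),
  cm_last_iterate a ip b f g Vk Mk pr prol LC k j u' p' ->
  `|u - u'| + `|p - p'| <= C * h k `^ s.
Proof.
(* [C0] pays for the discretization error; the stability constant times [Clc] pays for stopping the
   iteration. *)
exists (C0 + (m0^-1 + (m0 ^+ 2)^-1) * Clc) => V Q a ip a_norm ip_norm f g _ _ b _ _.
move=> Vk Mk Vk_fin Mk_fin _ h _ _ prol prol_Mk u p _ A1 pr _ s _ A3 LC A4.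
move=> k k1 j u' p' [x [y [run xy lc [-> ->]]]].
have Wfin i (i1 : (1 <= i)%N) : fin_dim_subspace (Vk i) by case: (Vk_fin i i1).
have Sfin i (i1 : (1 <= i)%N) : fin_dim_subspace (Mk i) by case: (Mk_fin i i1).
have [_ cx] := cm_run_consistent Wfin Sfin prol_Mk run.
have cy := cm2_consistent (Wfin _ k1) (Sfin _ k1) cx xy.
have [uk [pk sol]] := saddle_solvable a_norm ip_norm f g (Wfin _ k1) (Sfin _ k1)
  m0_gt0 (A1 _ k1).
have err := consistent_error a_norm ip_norm (Wfin _ k1) (Sfin _ k1) m0_gt0
  (A1 _ k1) sol cy.
have approx := A3 _ k1 _ _ sol.
have qy : (m0^-1 + (m0 ^+ 2)^-1) * `|it_q y| <=
          (m0^-1 + (m0 ^+ 2)^-1) * (Clc * h k `^ s).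
  by rewrite ler_wpM2l -?A4 // addr_ge0 // invr_ge0 ?exprn_ge0 // ltW.
(* Triangle inequalities through the discrete solution separate these two errors. *)
have trU := ler_distD uk u (it_u y).
have trP := ler_distD pk p (it_p y).
rewrite mulrDl -mulrA.
apply: le_trans (lerD trU trP) _; rewrite addrACA.
exact/(lerD approx)/(le_trans err).
Qed.
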